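(* For every knot type $[K]$, $2\,\mathrm{br}[K]+1\le \mathrm{pl}[K]$.
   Context: For a conformation $K$ of a knot (an embedded closed curve in $\mathbb{R}^3$ in the knot type) and a direction $p\in S^2$, let $\mathrm{br}(K,p)$ be the number of local maxima of $K$ with respect to the height function in direction $p$, where an extremum occurring along an interval of constant height is counted as a single extremum. The bridge index is $\mathrm{br}[K]=\min_{K\in[K]}\min_{p\in S^2}\mathrm{br}(K,p)$. A planar stick diagram of $[K]$ is a closed polygonal curve in the plane (finitely many straight line segments, called edges, joined end to end), whose self-intersections are transverse double points in the interiors of edges, with over/under crossing information at each self-intersection, representing $[K]$. The planar stick index $\mathrm{pl}[K]$ is the smallest number of edges in any planar stick diagram of $[K]$. *)

(* Defs.v *)
From HB Require Import structures.
From mathcomp Require Import all_boot all_order all_algebra.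
From mathcomp Require Import all_classical all_reals all_analysis.

Set Implicit Arguments.
Unset Strict Implicit.
Unset Printing Implicit Defensive.

Import Order.TTheory GRing.Theory Num.Theory.
Import numFieldNormedType.Exports.
Local Open Scope classical_set_scope.
Local Open Scope ring_scope.

Section Knots.
Variable R : realType.

Definition pt3 := 'rV[R]_3.
Definition pt2 := 'rV[R]_2.

Definition dot3 (p x : pt3) : R := \sum_(i < 3) p 0 i * x 0 i.
Definition unit_dir (p : pt3) : Prop := dot3 p p = 1.

Definition mk3 (x y z : R) : pt3 := \row_(i < 3) nth 0 [:: x; y; z] i.

Definition ambient_isotopic (A B : set pt3) : Prop :=
  exists H : R -> pt3 -> pt3,
    {within [set tx : R * pt3 | 0 <= tx.1 <= 1],
       continuous (fun tx : R * pt3 => H tx.1 tx.2)} /\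
    (forall t, 0 <= t <= 1 ->
       continuous (H t) /\
       exists g : pt3 -> pt3,
         cancel (H t) g /\ cancel g (H t) /\ continuous g) /\
    H 0 = id /\
    (H 1) @` A = B.

Definition seg3 (n : nat) (v : nat -> pt3) (i : nat) (s : R) : pt3 :=
  (1 - s) *: v i + s *: v (i.+1 %% n)%N.

Definition knot_set (n : nat) (v : nat -> pt3) : set pt3 :=
  [set x | exists i s, (i < n)%N /\ 0 <= s <= 1 /\ x = seg3 n v i s].

Definition polygonal_knot (n : nat) (v : nat -> pt3) : Prop :=
  (3 <= n)%N /\
  (forall i, (i < n)%N -> v i <> v (i.+1 %% n)%N) /\
  (forall i j s t, (i < n)%N -> (j < n)%N -> i <> j ->
     0 <= s <= 1 -> 0 <= t <= 1 -> seg3 n v i s = seg3 n v j t ->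
     (j = (i.+1 %% n)%N /\ s = 1 /\ t = 0) \/
     (i = (j.+1 %% n)%N /\ s = 0 /\ t = 1)).

(* ---------- br(K, p) for a polygonal conformation ----------
   Heights of the vertices in direction p.  The height function along
   the polygon is piecewise linear, so its local maxima are exactly the
   maximal cyclic runs of consecutive vertices of equal height whose two
   neighbouring vertices are strictly lower; each such run (an interval of
   constant height) counts as one maximum.  A run is identified by its
   first vertex i. If the height is constant along the whole knot, the
   whole curve is one single extremum (count 1). *)
Definition vheight (n : nat) (v : nat -> pt3) (p : pt3) (i : nat) : R :=
  dot3 p (v (i %% n)%N).

Definition br_at (n : nat) (v : nat -> pt3) (p : pt3) : nat :=
  let h := vheight n v p in
  if [forall i : 'I_n, h i == h 0%N] then 1%N else
  #|[set i : 'I_n |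
      (h (i + n.-1)%N < h i) &&
      [exists k : 'I_n,
         [forall j : 'I_n, (j <= k)%N ==> (h (i + j)%N == h i)] &&
         (h (i + k + 1)%N < h i)]]|.

Definition conformation (n0 : nat) (v0 : nat -> pt3) (m : nat) (u : nat -> pt3) :=
  polygonal_knot m u /\ ambient_isotopic (knot_set m u) (knot_set n0 v0).

Definition is_bridge_index (n0 : nat) (v0 : nat -> pt3) (b : nat) : Prop :=
  (exists m u p, conformation n0 v0 m u /\ unit_dir p /\ br_at m u p = b) /\
  (forall m u p, conformation n0 v0 m u -> unit_dir p -> (b <= br_at m u p)%N).

Definition seg2 (n : nat) (w : nat -> pt2) (i : nat) (s : R) : pt2 :=
  (1 - s) *: w i + s *: w (i.+1 %% n)%N.

Definition cross2 (a b : pt2) : R := a 0 0 * b 0 1 - a 0 1 * b 0 0.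

Definition adjacent (n i j : nat) : Prop :=
  j = (i.+1 %% n)%N \/ i = (j.+1 %% n)%N.

Definition planar_stick_polygon (n : nat) (w : nat -> pt2) : Prop :=
  (3 <= n)%N /\
  (forall i, (i < n)%N -> w i <> w (i.+1 %% n)%N) /\
  (forall i s t, (i < n)%N -> 0 <= s <= 1 -> 0 <= t <= 1 ->
     seg2 n w i s = seg2 n w (i.+1 %% n)%N t -> s = 1 /\ t = 0) /\
  (forall i j s t, (i < n)%N -> (j < n)%N -> i <> j -> ~ adjacent n i j ->
     0 <= s <= 1 -> 0 <= t <= 1 -> seg2 n w i s = seg2 n w j t ->
     (0 < s < 1) /\ (0 < t < 1) /\
     cross2 (w (i.+1 %% n)%N - w i) (w (j.+1 %% n)%N - w j) != 0) /\
  (forall i j k s t u, (i < n)%N -> (j < n)%N -> (k < n)%N ->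
     i <> j -> j <> k -> i <> k ->
     0 <= s <= 1 -> 0 <= t <= 1 -> 0 <= u <= 1 ->
     ~ (seg2 n w i s = seg2 n w j t /\ seg2 n w j t = seg2 n w k u)).

(* The over/under information is encoded by a lift: a continuous height z
   along the diagram curve (z i s is the height above the point seg2 n w i s)
   which differs at the two preimages of every crossing; the strand with the
   larger height is the over-strand.  The diagram represents the knot whose
   underlying space curve is the lift. *)
Definition diagram_lift (n : nat) (w : nat -> pt2) (z : nat -> R -> R) : Prop :=
  (forall i, (i < n)%N -> {within `[0, 1], continuous (z i)}) /\
  (forall i, (i < n)%N -> z i 1 = z (i.+1 %% n)%N 0) /\
  (forall i j s t, (i < n)%N -> (j < n)%N -> i <> j -> ~ adjacent n i j ->
     0 <= s <= 1 -> 0 <= t <= 1 -> seg2 n w i s = seg2 n w j t ->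
     z i s <> z j t).

Definition lift_set (n : nat) (w : nat -> pt2) (z : nat -> R -> R) : set pt3 :=
  [set x | exists i s, (i < n)%N /\ 0 <= s <= 1 /\
     x = mk3 (seg2 n w i s 0 0) (seg2 n w i s 0 1) (z i s)].

Definition planar_stick_diagram_of (n0 : nat) (v0 : nat -> pt3)
    (m : nat) (w : nat -> pt2) (z : nat -> R -> R) : Prop :=
  planar_stick_polygon m w /\ diagram_lift m w z /\
  ambient_isotopic (lift_set m w z) (knot_set n0 v0).

Definition is_planar_stick_index (n0 : nat) (v0 : nat -> pt3) (q : nat) : Prop :=
  (exists w z, planar_stick_diagram_of n0 v0 q w z) /\
  (forall m w z, planar_stick_diagram_of n0 v0 m w z -> (q <= m)%N).

End Knots.

(* Main.v *)
(** Subdivide every edge of a stick diagram at its crossings, lift the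
    subdivision points to the knot and join them by straight segments.  The
    resulting polygonal knot has the same shadow as the given lift and the same
    heights at the crossings, so the difference of the two heights vanishes at
    every crossing and is a well-defined continuous function on the planar
    curve.  Extended to the plane by Tietze's theorem, it generates a vertical
    shear isotopy between the two knots.  Seen from a horizontal direction
    perpendicular to one edge of the diagram, that edge is level, and each local
    maximum of the polygon is preceded by an ascending edge and followed by a
    descending edge of the diagram, all of these being distinct. *)

Require Import Defs.
From HB Require Import structures.
From mathcomp Require Import all_boot all_order all_algebra.
From mathcomp Require Import all_classical all_reals all_analysis.
From mathcomp Require Import ring lra.

Set Implicit Arguments.
Unset Strict Implicit.
Unset Printing Implicit Defensive.

Import Order.TTheory GRing.Theory Num.Theory.
Import numFieldNormedType.Exports.
Local Open Scope classical_set_scope.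
Local Open Scope ring_scope.

(** * Ambient isotopies and shears *)

Lemma pair_continuousl (T U : topologicalType) (t : T) :
  continuous (fun x : U => (t, x)).
Proof. by move=> x; apply: cvg_pair; [exact: cvg_cst|exact: cvg_id]. Qed.

Lemma within_comp_continuous (T U V : topologicalType) (A : set T) (B : set U)
    (f : T -> U) (g : U -> V) :
  (forall x, A x -> B (f x)) ->
  {within A, continuous f} -> {within B, continuous g} ->
  {within A, continuous (g \o f)}.
Proof.
move=> AB /subspace_continuousP cf /subspace_continuousP cg.
apply/subspace_continuousP => x Ax.
apply: cvg_trans (cg _ (AB _ Ax)).
move=> P /= gP.
have /= := cf x Ax _ gP.
rewrite /nbhs /= /within /=; apply: filterS => y /= Py Ay.
exact: Py (Ay) (AB _ Ay).
Qed.

Lemma within_pair_continuous (T U V : topologicalType) (A : set T)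
    (f : T -> U) (g : T -> V) :
  {within A, continuous f} -> {within A, continuous g} ->
  {within A, continuous (fun x => (f x, g x))}.
Proof.
move=> /subspace_continuousP cf /subspace_continuousP cg.
by apply/subspace_continuousP => x Ax; apply: cvg_pair; [exact: cf|exact: cg].
Qed.

Section Isotopy.
Variable R : realType.
Implicit Types A B C : set 'rV[R]_3.

(* The composite [K t \o H t] avoids concatenating the two isotopies in time. *)
Lemma ambient_isotopic_trans A B C :
  ambient_isotopic A B -> ambient_isotopic B C -> ambient_isotopic A C.
Proof.
move=> [H [cH [hH [H0 <-]]]] [K [cK [hK [K0 <-]]]].
exists (fun t => K t \o H t); split; last split; last split.
- pose h (tx : R * 'rV[R]_3) := (tx.1, H tx.1 tx.2).
  apply: (within_comp_continuous (f := h)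
    (g := fun tx : R * 'rV[R]_3 => K tx.1 tx.2) _ _ cK) => //.
  apply: within_pair_continuous => //.
  by apply: continuous_subspaceT => x; exact: cvg_fst.
- move=> t t01.
  have [cHt [g [Hg [gH cg]]]] := hH t t01.
  have [cKt [k [Kk [kK ck]]]] := hK t t01.
  split; first by move=> x; apply: continuous_comp; [exact: cHt|exact: cKt].
  exists (g \o k); split; last split.
  + by move=> x /=; rewrite Kk Hg.
  + by move=> x /=; rewrite gH kK.
  + by move=> x; apply: continuous_comp; [exact: ck|exact: cg].
- by rewrite H0 K0.
- by rewrite image_comp.
Qed.

(** Vertical projection to the plane of the diagram, written with basis vectors so that its
    continuity comes from that of two coordinates. *)
Definition shadow (x : 'rV[R]_3) : 'rV[R]_2 :=
  x 0 0 *: delta_mx 0 0 + x 0 1 *: delta_mx 0 1.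

Lemma shadowE (x : 'rV[R]_3) : (shadow x 0 0 = x 0 0) * (shadow x 0 1 = x 0 1).
Proof. by rewrite !mxE /= !mulr1 !mulr0 addr0 add0r. Qed.

Lemma shadow_continuous : continuous shadow.
Proof.
move=> x; pose cvgZ2 := @cvgZr_tmp R 'rV[R]_2 _ (nbhs x).
exact: (@cvgD R 'rV[R]_2 _ _ _ _ _ _ _
  (cvgZ2 _ _ _ _ (@coord_continuous R _ _ 0 0 x))
  (cvgZ2 _ _ _ _ (@coord_continuous R _ _ 0 1 x))).
Qed.

Definition shear (G : 'rV[R]_2 -> R) (t : R) (x : 'rV[R]_3) : 'rV[R]_3 :=
  x + (t * G (shadow x)) *: delta_mx 0 ord_max.

Lemma shadow_shear G t x : shadow (shear G t x) = shadow x.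
Proof. by rewrite /shadow !mxE /= !mulr0 !addr0. Qed.

(** A shear moves points vertically, so [G] takes the same value before and after and the
    displacement can be undone. *)
Lemma shearK G t : cancel (shear G t) (shear G (- t)).
Proof.
by move=> x; rewrite {1}/shear shadow_shear /shear mulNr scaleNr addrK.
Qed.

Lemma shear_continuous G : continuous G ->
  continuous (fun tx : R * 'rV[R]_3 => shear G tx.1 tx.2).
Proof.
move=> cG tx.
have cGs : (G (shadow y.2)) @[y --> tx] --> G (shadow tx.2).
  apply: (cvg_comp (fun y : R * 'rV[R]_3 => shadow y.2) G _ (cG _)).
  exact: (cvg_comp snd shadow cvg_snd (@shadow_continuous tx.2)).
have F : Filter (nbhs tx) := nbhs_filter (tx : R * 'rV[R]_3).
have c1 : y.1 @[y --> tx] --> tx.1 by exact: cvg_fst.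
have c2 : y.2 @[y --> tx] --> tx.2 by exact: cvg_snd.
have cz := @cvgZr_tmp R 'rV[R]_3 _ _ F _ _ (delta_mx 0 ord_max)
  (@cvgM R _ _ F _ _ _ _ c1 cGs).
exact: (@cvgD R 'rV[R]_3 _ _ F _ _ _ _ c2 cz).
Qed.

(** The amount of shear serves as time: [shear G 0] is the identity, and each stage is inverted by
    [shear G (- t)]. *)
Lemma shear_isotopic (G : 'rV[R]_2 -> R) A : continuous G ->
  ambient_isotopic A (shear G 1 @` A).
Proof.
move=> /shear_continuous cG.
have cGt t : continuous (shear G t).
  move=> x; apply: (cvg_comp (fun y => (t, y)) _ _ (cG (t, x))).
  exact: pair_continuousl.
exists (shear G); split; [exact: continuous_subspaceT|split; [|split=> //]].
- move=> t _; split; first exact: cGt.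
  exists (shear G (- t)); split; [exact: shearK|split; last exact: cGt].
  by rewrite -{2}(opprK t); exact: shearK.
- by apply/funext => x; rewrite /shear mul0r scale0r addr0.
Qed.

Lemma row3P (x y : 'rV[R]_3) :
  x 0 0 = y 0 0 -> x 0 1 = y 0 1 -> x 0 ord_max = y 0 ord_max -> x = y.
Proof.
move=> e0 e1 e2; apply/rowP => -[[|[|[|//]]] lt3].
- by rewrite (_ : Ordinal lt3 = 0) //; exact: val_inj.
- by rewrite (_ : Ordinal lt3 = 1) //; exact: val_inj.
- by rewrite (_ : Ordinal lt3 = ord_max) //; exact: val_inj.
Qed.

Lemma row2P (x y : 'rV[R]_2) : x 0 0 = y 0 0 -> x 0 1 = y 0 1 -> x = y.
Proof.
move=> e0 e1; apply/rowP => -[[|[|//]] lt2].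
- by rewrite (_ : Ordinal lt2 = 0) //; exact: val_inj.
- by rewrite (_ : Ordinal lt2 = 1) //; exact: val_inj.
Qed.

End Isotopy.

(** * Extending a function from finitely many arcs *)

(** On each arc the function is [g k \o inv k], hence continuous; the arcs are compact, so it is
    continuous and bounded on their closed union, and the bounded Tietze theorem applies. *)
Lemma glued_extension (R : realType) (X : pseudoMetricType R) (m : nat)
    (c : nat -> R -> X) (inv : nat -> X -> R) (g : nat -> R -> R) :
  hausdorff_space X ->
  (forall k, (k < m)%N -> continuous (c k)) ->
  (forall k, (k < m)%N -> continuous (inv k)) ->
  (forall k, (k < m)%N -> cancel (c k) (inv k)) ->
  (forall k, (k < m)%N -> {within `[0, 1], continuous (g k)}) ->
  (forall k l s t, (k < m)%N -> (l < m)%N -> 0 <= s <= 1 -> 0 <= t <= 1 ->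
     c k s = c l t -> g k s = g l t) ->
  exists G : X -> R, continuous G /\
    forall k s, (k < m)%N -> 0 <= s <= 1 -> G (c k s) = g k s.
Proof.
move=> hX cc cinv cK cg compat.
(* Any preimage may be chosen, because [compat] makes the value independent of it; the default pair
   matters only off the arcs. *)
pose G0 (x : X) : R := let ks := xget (0%N, 0)
  [set ks | (ks.1 < m)%N /\ 0 <= ks.2 <= 1 /\ c ks.1 ks.2 = x] in g ks.1 ks.2.
have G0E k s : (k < m)%N -> 0 <= s <= 1 -> G0 (c k s) = g k s.
  move=> km s01; rewrite /G0; case: xgetP => [[l t] _ /= [lm [t01 e]]|].
    exact: compat.
  by move=> /(_ (k, s)) /=; case.
pose D k := c k @` `[0, 1].
have cD k : (k < m)%N -> compact (D k).
  move=> km; apply: continuous_compact; last exact: segment_compact.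
  by apply: continuous_subspaceT; exact: cc.
have DG k : (k < m)%N -> {within D k, continuous G0}.
  move=> km; have cgi : {within D k, continuous (g k \o inv k)}.
    apply: (within_comp_continuous (f := inv k) _ _ (cg _ km)).
      by move=> x [s s01 <-]; rewrite cK.
    by apply: continuous_subspaceT; exact: cinv.
  apply: (@subspace_eq_continuous _ _ _ (from_subspace (D k) (g k \o inv k))) cgi.
  by move=> x /set_mem [s /= s01 <-]; rewrite /from_subspace /= cK// G0E//.
have [cU UG] : compact (\big[setU/set0]_(k < m) D k) /\
    {within \big[setU/set0]_(k < m) D k, continuous G0}.
  apply: (big_ind (fun A => compact A /\ {within A, continuous G0})).
  - by split; [exact: compact0|exact: continuous_subspace0].
  - move=> A B [cA gA] [cB gB]; split; first exact: compactU.
    by apply: withinU_continuous => //; exact: compact_closed.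
  - by move=> k _; split; [exact: cD|exact: DG].
have [M [Mr bM]] := compact_bounded (continuous_compact UG cU).
(* [bM] bounds the values by every number above [M]; [|M| + 1] is such a number and is positive. *)
have M0 : 0 < `|M| + 1 by rewrite ltr_wpDl.
have [x Ux|G [GG0 cG _]] := continuous_bounded_extension
  pseudometric_normal (compact_closed hX cU) M0 UG.
  apply: (bM (`|M| + 1)); last by exists x.
  by rewrite (le_lt_trans (ler_norm M))// ltrDl.
exists G; split=> // k s km s01; rewrite -GG0 ?G0E//.
by apply/mem_set; rewrite (bigD1 (Ordinal km))//=; left; exists s.
Qed.

(** * Counting maxima *)

Section CountMaxima.
(* A cyclic sequence of [n * N] heights, monotone on each of the [n] edges;
   [D e] has the sign of the slope of edge [e]. *)
Variables (R : realDomainType) (n N : nat) (h D : nat -> R).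
Hypotheses (N_gt0 : (0 < N)%N) (n_gt0 : (0 < n)%N).
Let m := (n * N)%N.
Let edge k := ((k %% m) %/ N)%N.
Hypothesis h_mod : forall k, h k = h (k %% m)%N.
Hypothesis h_step : forall k, Num.sg (h k.+1 - h k) = Num.sg (D (edge k)).
Hypothesis D0 : D 0%N = 0.

Let m_gt0 : (0 < m)%N. Proof. by rewrite muln_gt0 n_gt0. Qed.

Let h_eqmod k l : k = l %[mod m] -> h k = h l.
Proof. by move=> e; rewrite h_mod e -h_mod. Qed.

Let h_lt k : (h k < h k.+1) = (0 < D (edge k)).
Proof. by rewrite -[RHS]sgr_gt0 -h_step sgr_gt0 subr_gt0. Qed.

Let h_gt k : (h k.+1 < h k) = (D (edge k) < 0).
Proof. by rewrite -[RHS]sgr_lt0 -h_step sgr_lt0 subr_lt0. Qed.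

Let edge_lt k : (edge k < n)%N.
Proof. by rewrite ltn_divLR// ltn_mod. Qed.

(** Adding [m.-1] steps back by one modulo [m]. Unless [k] is a corner of the diagram, the steps
    into and out of [k] belong to one edge. *)
Let edge_pred k : (k %% N != 0)%N -> edge (k + m.-1) = edge k.
Proof.
move=> kN; have x0 : (0 < k %% m)%N.
  rewrite lt0n; apply: contraNneq kN => km0.
  by rewrite (divn_eq k m) km0 addn0 mulnA modnMl.
have xm : (k %% m < m)%N by rewrite ltn_mod.
rewrite /edge -modnDml (_ : (k %% m + m.-1 = (k %% m).-1 + m)%N); last first.
  by rewrite -!subn1 addnBA// addnBAC.
rewrite modnDr modn_small ?(leq_ltn_trans (leq_pred _))//.
have kmN : ((k %% m) %% N)%N = (k %% N)%N by rewrite modn_dvdm// dvdn_mull.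
have := divn_eq (k %% m) N; rewrite kmN; case: (k %% N)%N kN kmN (ltn_pmod k N_gt0).
  by [].
move=> b _ _ bN {1}->.
by rewrite addnS divnMDl// (divn_small (ltnW bN)) addn0.
Qed.

Let edge_inj k l : (N %| k)%N -> (N %| l)%N -> edge k = edge l -> k = l %[mod m].
Proof.
move=> Nk Nl e; have dm x : (N %| x)%N -> (N %| x %% m)%N.
  by move=> Nx; rewrite /dvdn modn_dvdm ?dvdn_mull.
by rewrite -(divnK (dm _ Nk)) -(divnK (dm _ Nl)) -/(edge k) -/(edge l) e.
Qed.

Let plateau (i k : nat) := (forall j, (j <= k)%N -> h (i + j)%N = h i) /\
  h (i + k).+1 < h i.

(** If [i] were interior to an edge, the ascent into [i] would continue out of it, contradicting a
    level or descending next step. *)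
Let start_dvd i k : h (i + m.-1)%N < h i -> plateau i k -> (N %| i)%N.
Proof.
move=> up [run down]; apply: contraT => /edge_pred ei.
have {up} : h (i + m.-1)%N < h (i + m.-1).+1.
  by rewrite -addnS prednK// (@h_eqmod (i + m) i) ?modnDr.
(* The next step descends when [k] is zero and is level otherwise. *)
rewrite h_lt ei -h_lt; case: k run down => [|k] run; rewrite ?addn0.
  by move=> /ltW; rewrite leNgt => /negP.
by have := run 1%N isT; rewrite addn1 => ->; rewrite ltxx.
Qed.

(** Mirror argument: inside an edge the descent out of [i + k] would force a descent into it, but
    that step is the ascent [up] or a level step of the run. *)
Let stop_dvd i k : h (i + m.-1)%N < h i -> plateau i k -> (N %| i + k)%N.
Proof.
move=> up [run]; rewrite -(run _ (leqnn k)) h_gt => down.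
apply: contraT => /edge_pred e; move: down; rewrite -e -h_gt.
rewrite -addnS prednK// (@h_eqmod (i + k + m) (i + k)) ?modnDr// run//.
case: k run {e} => [|k] run; first by rewrite addn0 => /(lt_trans up); rewrite ltxx.
rewrite addnS addSn -addnS prednK// (@h_eqmod (i + k + m) (i + k)) ?modnDr//.
by rewrite run ?ltxx.
Qed.

(** The last step of edge [e] ends at the corner [e.+1 * N] modulo [m], so the edge arriving at a
    corner determines it. *)
Let edge_pred_inj k l : (N %| k)%N -> (N %| l)%N ->
  edge (k + m.-1) = edge (l + m.-1) -> k = l %[mod m].
Proof.
move=> Nk Nl; rewrite /edge => e.
have F x : (N %| x)%N -> ((x + m.-1) %% m).+1 = (((x + m.-1) %% m) %/ N).+1 * N %[mod m].
  move=> Nx; have Ny : (N %| ((x + m.-1) %% m).+1)%N.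
    rewrite -addn1 /dvdn -modnDml modn_dvdm ?dvdn_mull// modnDml.
    by rewrite -addnA addn1 prednK// -/(dvdn _ _) dvdn_add// dvdn_mull.
  by rewrite -{1}(divnK Ny) divnS// Ny add1n.
have S x : ((x + m.-1) %% m).+1 = x %[mod m].
  by rewrite -addn1 modnDml -addnA addn1 prednK// modnDr.
by rewrite -(S k) -(S l) (F k)// (F l)// e.
Qed.

(** With a common end, the shorter run starts inside the longer one, at offset [l - k]. A positive
    offset would put the vertex before [i] in the run of [j] too, at the height of [i], against the
    ascent [up]. *)
Let plateau_end_inj i j k l :
  h (i + m.-1)%N < h i -> plateau i k -> plateau j l -> (k <= l)%N ->
  i + k = j + l %[mod m] -> i = j %[mod m].
Proof.
move=> up _ [run _] kl e.
have {}e : i = j + (l - k) %[mod m].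
  by apply/eqP; rewrite -(eqn_modDr k) -addnA subnK// e.
move: e up; case d : (l - k)%N => [|d'] e; first by rewrite addn0 in e.
have dl : (d'.+1 <= l)%N by rewrite -d leq_subr.
rewrite (@h_eqmod i (j + d'.+1))// (run d'.+1)// (@h_eqmod (i + m.-1) (j + d')).
  by rewrite run ?ltxx// ltnW.
by rewrite -modnDml e modnDml addnS addSn -addnS prednK// modnDr.
Qed.

Let edge_ord k : 'I_n := Ordinal (edge_lt k).

(** A maximum is sent to the edge arriving at its plateau and to the edge leaving it. Both maps are
    injective, with values in the disjoint sets of ascending and descending edges, and the level
    edge [0] lies in neither. *)
Lemma twice_maxima_le (M : {set 'I_m}) :
  (forall i, i \in M -> h (i + m.-1)%N < h i /\ exists k, plateau i k) ->
  (2 * #|M| + 1 <= n)%N.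
Proof.
move=> MP.
have ord_eqmod (i j : 'I_m) : i = j %[mod m] -> i = j.
  by rewrite !modn_small//; exact: val_inj.
have up_inj : {in M &, injective (fun i : 'I_m => edge_ord (i + m.-1))}.
  move=> i j Mi Mj /(congr1 val) /= e.
  have [upi [k pi]] := MP _ Mi; have [upj [l pj]] := MP _ Mj.
  by apply: ord_eqmod; apply: edge_pred_inj e; [exact: start_dvd pi|exact: start_dvd pj].
have /choice[len lenP] : forall i, exists k, i \in M -> plateau i k.
  move=> i; have [/MP[_ [k pk]]|_] := boolP (i \in M); first by exists k.
  by exists 0%N.
have down_inj : {in M &, injective (fun i : 'I_m => edge_ord (i + len i))}.
  move=> i j Mi Mj /(congr1 val) /= e.
  have [upi _] := MP _ Mi; have [upj _] := MP _ Mj.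
  have pi := lenP _ Mi; have pj := lenP _ Mj.
  have {}e := edge_inj (stop_dvd upi pi) (stop_dvd upj pj) e.
  (* [plateau_end_inj] expects the shorter run first, hence the comparison of lengths. *)
  apply: ord_eqmod; have [ll|/ltnW ll] := leqP (len i) (len j).
    exact: plateau_end_inj upi pi pj ll e.
  by rewrite (plateau_end_inj upj pj pi ll).
pose U := [set e : 'I_n | 0 < D e]%SET; pose L := [set e : 'I_n | D e < 0]%SET.
have MU : (#|M| <= #|U|)%N.
  rewrite -(card_in_imset up_inj); apply/subset_leq_card/fintype.subsetP => _ /imsetP[i Mi ->].
  have [up _] := MP _ Mi; rewrite inE.
  suff : h (i + m.-1)%N < h (i + m.-1).+1 by rewrite h_lt.
  by rewrite -addnS prednK// (@h_eqmod (i + m) i) ?modnDr.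
have ML : (#|M| <= #|L|)%N.
  rewrite -(card_in_imset down_inj); apply/subset_leq_card/fintype.subsetP => _ /imsetP[i Mi ->].
  have [run down] := lenP _ Mi; rewrite inE.
  by move: down; rewrite -(run _ (leqnn _)) h_gt.
have UL : U :&: L = finset.set0.
  apply/finset.setP => e; rewrite !inE; apply/negP => /andP[/lt_trans h1 /h1].
  by rewrite ltxx.
(* Edge [0], the set [U] and the set [L] contribute separately to the [n] edges. *)
have := subset_leq_card (finset.subsetT (Ordinal n_gt0 |: (U :|: L))).
rewrite cardsU1 !inE D0 ltxx/= cardsT card_ord cardsU UL cards0 subn0 => ULn.
rewrite addnC; apply: leq_trans ULn; rewrite leq_add2l mul2n -addnn.
exact: leq_add.
Qed.

End CountMaxima.

(** * The subdivided diagram *)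

Section Breakpoints.
Variable R : realType.

Lemma breakpointsP (S : seq R) : exists (N : nat) (sg : nat -> R),
  [/\ (0 < N)%N, sg 0%N = 0, sg N = 1,
      forall r, (r < N)%N -> sg r < sg r.+1 &
      forall c, c \in S -> 0 <= c < 1 -> exists2 r, (r < N)%N & sg r = c].
Proof.
pose L := sort <=%O (undup (0 :: [seq c <- S | 0 <= c < 1])).
have memL c : c \in L = (c == 0) || ((0 <= c < 1) && (c \in S)).
  by rewrite mem_sort mem_undup inE mem_filter.
have L01 c : c \in L -> 0 <= c < 1.
  by rewrite memL => /orP[/eqP->|/andP[]//]; rewrite lexx ltr01.
have srt : sorted <%O L by rewrite sort_lt_sorted undup_uniq.
have L0 : (0 < size L)%N.
  by have : 0 \in L by [rewrite memL eqxx]; case: (L).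
have step r : (r < size L)%N -> nth 1 L r < nth 1 L r.+1.
  move=> rN; have [r1N|Nr1] := ltnP r.+1 (size L).
    exact: (sortedP 1 srt).
  by rewrite [ltRHS]nth_default//; case/andP: (L01 _ (mem_nth 1 rN)).
(* The final breakpoint [1] is not in [L]: it is the default value of [nth] at index [size L]. *)
exists (size L), (nth 1 L); split=> //.
- have /(nthP 1)[i iN i0] : 0 \in L by rewrite memL eqxx.
  apply/eqP; rewrite eq_le; apply/andP; split.
    rewrite -[leRHS]i0 (sorted_leq_nth le_trans le_refl)// ?inE//.
    by apply: sub_sorted srt => x y /ltW.
  by case/andP: (L01 _ (mem_nth 1 L0)).
- by rewrite nth_default.
- move=> c cS c01; have /(nthP 1)[r rN rc] : c \in L by rewrite memL cS c01 orbT.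
  by exists r.
Qed.

Variables (N : nat) (sg : nat -> R).
Hypothesis sg_step : forall r, (r < N)%N -> sg r < sg r.+1.

Lemma breakpoints_le r q : (r <= q)%N -> (q <= N)%N -> sg r <= sg q.
Proof.
move=> rq; rewrite -(subnK rq) addnC; elim: (q - r)%N => [|d IH]; first by rewrite addn0.
by rewrite addnS => dN; apply: le_trans (IH (ltnW dN)) (ltW (sg_step dN)).
Qed.

Lemma breakpoints_lt r q : (r < q)%N -> (q <= N)%N -> sg r < sg q.
Proof.
by move=> rq qN; apply: lt_le_trans (breakpoints_le rq qN); apply/sg_step/(leq_trans rq).
Qed.

Lemma breakpoints_bracket x : sg 0%N <= x <= sg N -> (0 < N)%N ->
  exists2 r, (r < N)%N & sg r <= x <= sg r.+1.
Proof.
move=> /andP[x0 xN] N0.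
suff H q : (0 < q <= N)%N -> x <= sg q ->
    exists2 r, (r < q)%N & sg r <= x <= sg r.+1.
  by apply: H => //; rewrite N0 leqnn.
elim: q => // q IH /andP[_ qN] xq.
have [xq'|qx] := leP x (sg q); last by exists q => //; rewrite (ltW qx).
case: q IH qN xq xq' => [|q] IH qN xq xq'; first by exists 0%N => //; rewrite x0.
have [r rq rx] := IH (ltnW qN) xq'.
by exists r => //; apply: ltnW.
Qed.

End Breakpoints.

(** The parameter is read off from a coordinate in which the endpoints differ. The formula is affine
    on the whole plane, which supplies the global inverses required by [glued_extension]. *)
Lemma segment_parameter (R : realType) (A B : 'rV[R]_2) : A <> B ->
  exists2 f : 'rV[R]_2 -> R, continuous f &
    forall s, f ((1 - s) *: A + s *: B) = s.
Proof.
move=> AB; have [j jAB] : exists j, A 0 j != B 0 j.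
  apply: contrapT => nex; apply: AB; apply/rowP => j; apply/eqP.
  by apply: contrapT => /negP jAB; apply: nex; exists j.
have cg : continuous (fun y : R => (y - A 0 j) * (B 0 j - A 0 j)^-1).
  move=> y; apply: cvgM; last exact: cvg_cst.
  by apply: cvgB; [exact: cvg_id|exact: cvg_cst].
exists (fun x => (x 0 j - A 0 j) * (B 0 j - A 0 j)^-1) => [x|s].
  exact: (cvg_comp _ _ (@coord_continuous R 1 2 0 j x) (cg _)).
by rewrite !mxE; field; rewrite subr_eq0 eq_sym.
Qed.

Lemma segment_continuous (R : realType) (A B : 'rV[R]_2) :
  continuous (fun s : R => (1 - s) *: A + s *: B).
Proof.
move=> s; have F : Filter (nbhs s) := nbhs_filter s.
have c1 : 1 - x @[x --> s] --> 1 - s.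
  by apply: cvgB; [exact: cvg_cst|exact: cvg_id].
have c2 : x @[x --> s] --> s by exact: cvg_id.
have cA : (1 - x) *: A @[x --> s] --> (1 - s) *: A.
  exact: (@cvgZr_tmp R 'rV[R]_2 _ _ F _ _ A c1).
have cB : x *: B @[x --> s] --> s *: B.
  exact: (@cvgZr_tmp R 'rV[R]_2 _ _ F _ _ B c2).
exact: (@cvgD R 'rV[R]_2 _ _ F _ _ _ _ cA cB).
Qed.

(** * The polygon inscribed in the lift, and its isotopy to the lift *)

Section Subdivision.
Variables (R : realType) (n : nat) (w : nat -> 'rV[R]_2) (z : nat -> R -> R).
Hypotheses (polyw : planar_stick_polygon n w) (liftz : diagram_lift n w z).
Variables (N : nat) (sg : nat -> R).
(* All edges share the breakpoints [sg 0 = 0 < ... < sg N = 1], so the [k]-th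
   vertex of the subdivision lies on edge [k %/ N], at parameter
   [sg (k %% N)]. *)
Hypotheses (N_gt0 : (0 < N)%N) (sg0 : sg 0%N = 0) (sgN : sg N = 1).
Hypothesis sg_step : forall r, (r < N)%N -> sg r < sg r.+1.

Definition crossing_param i s := exists j t,
  [/\ (i < n)%N, (j < n)%N, i <> j & ~ Defs.adjacent n i j] /\
  [/\ 0 <= s <= 1, 0 <= t <= 1 & seg2 n w i s = seg2 n w j t].

Hypothesis sg_crossing : forall i s, crossing_param i s ->
  exists2 r, (r < N)%N & sg r = s.

Let m := (n * N)%N.

Let n_gt0 : (0 < n)%N. Proof. by case: polyw => /ltnW /ltnW. Qed.
Let m_gt0 : (0 < m)%N. Proof. by rewrite muln_gt0 n_gt0. Qed.
Let rem_lt k : (k %% N < N)%N. Proof. by rewrite ltn_mod. Qed.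
Let edge_lt k : (k < m)%N -> (k %/ N < n)%N.
Proof. by move=> km; rewrite ltn_divLR. Qed.

Definition lift_point i s : 'rV[R]_3 :=
  mk3 (seg2 n w i s 0 0) (seg2 n w i s 0 1) (z i s).

Definition subdivided k := lift_point (k %/ N) (sg (k %% N)).

(** Affine change of parameter from the [k]-th segment of the subdivision to the edge containing
    it. *)
Definition sub_param k s : R := (1 - s) * sg (k %% N) + s * sg (k %% N).+1.

Lemma shadow_mk3 (x : 'rV[R]_2) c : shadow (mk3 (x 0 0) (x 0 1) c) = x.
Proof. by apply: row2P; rewrite shadowE mxE. Qed.

Lemma shadow_lift_point i s : shadow (lift_point i s) = seg2 n w i s.
Proof. exact: shadow_mk3. Qed.

Lemma lift_point_height i s : lift_point i s 0 ord_max = z i s.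
Proof. by rewrite mxE. Qed.

Lemma shadowD (x y : 'rV[R]_3) a b :
  shadow (a *: x + b *: y) = a *: shadow x + b *: shadow y.
Proof. by apply: row2P; rewrite !(shadowE, mxE)/= ?mulr1 ?mulr0; ring. Qed.

Lemma seg2_combination i a b s :
  (1 - s) *: seg2 n w i a + s *: seg2 n w i b =
  seg2 n w i ((1 - s) * a + s * b).
Proof. by apply/rowP => j; rewrite !mxE; ring. Qed.

Lemma seg2_0 i : seg2 n w i 0 = w i.
Proof. by rewrite /seg2 subr0 scale1r scale0r addr0. Qed.

Lemma seg2_1 i : seg2 n w i 1 = w (i.+1 %% n)%N.
Proof. by rewrite /seg2 subrr scale1r scale0r add0r. Qed.

Lemma lift_point_end i : (i < n)%N -> lift_point i 1 = lift_point (i.+1 %% n)%N 0.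
Proof.
by move=> i_n; case: liftz => _ [ze _]; rewrite /lift_point seg2_1 seg2_0 ze.
Qed.

(** Describes both ends of a segment on a single edge: at a corner, [sg N = 1] and the lift closes
    up with parameter [0] of the next edge. *)
Lemma subdivided_next k : (k < m)%N ->
  subdivided (k.+1 %% m)%N = lift_point (k %/ N) (sg (k %% N).+1).
Proof.
move=> km; have kn := edge_lt km.
have ek : k.+1 = (k %/ N * N + (k %% N).+1)%N by rewrite addnS -divn_eq.
have [rN|Nr] := ltnP (k %% N).+1 N.
  have k1m : (k.+1 < m)%N.
    rewrite ek; apply: (@leq_trans ((k %/ N).+1 * N)%N); last by rewrite leq_mul2r kn orbT.
    by rewrite mulSn addnC ltn_add2r.
  by rewrite modn_small// /subdivided ek divnMDl// modnMDl (divn_small rN) addn0 (modn_small rN).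
have rN : (k %% N).+1 = N by apply/eqP; rewrite eqn_leq Nr rem_lt.
rewrite rN sgN lift_point_end// ek rN -mulSnr -muln_modl.
by rewrite /subdivided mulnK// modnMl sg0.
Qed.

Lemma seg3_subdivided k s : (k < m)%N -> seg3 m subdivided k s =
  (1 - s) *: lift_point (k %/ N) (sg (k %% N)) +
  s *: lift_point (k %/ N) (sg (k %% N).+1).
Proof. by move=> km; rewrite /seg3 subdivided_next. Qed.

Lemma shadow_seg3 k s : (k < m)%N ->
  shadow (seg3 m subdivided k s) = seg2 n w (k %/ N) (sub_param k s).
Proof.
by move=> km; rewrite seg3_subdivided// shadowD !shadow_lift_point seg2_combination.
Qed.

Lemma seg3_height k s : (k < m)%N -> seg3 m subdivided k s 0 ord_max =
  (1 - s) * z (k %/ N) (sg (k %% N)) + s * z (k %/ N) (sg (k %% N).+1).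
Proof.
by move=> km; rewrite seg3_subdivided// !mxE.
Qed.

Lemma sub_param_bounds k s : 0 <= s <= 1 ->
  sg (k %% N) <= sub_param k s <= sg (k %% N).+1.
Proof.
move=> /andP[s0 s1]; have := sg_step (rem_lt k); rewrite /sub_param.
by move=> ?; apply/andP; split; nra.
Qed.

Lemma sg_bounds r : (r <= N)%N -> 0 <= sg r <= 1.
Proof.
move=> rN; rewrite -sg0 -sgN.
by rewrite !(breakpoints_le sg_step).
Qed.

Lemma sub_param01 k s : 0 <= s <= 1 -> 0 <= sub_param k s <= 1.
Proof.
move=> /(sub_param_bounds k)/andP[h1 h2].
have /andP[h3 _] := sg_bounds (ltnW (rem_lt k)).
have /andP[_ h4] := sg_bounds (rem_lt k).
by rewrite (le_trans h3)// (le_trans h2).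
Qed.

Lemma sub_param_inj k s t : sub_param k s = sub_param k t -> s = t.
Proof.
have := sg_step (rem_lt k); rewrite /sub_param -subr_gt0 => d0 e.
have : (s - t) * (sg (k %% N).+1 - sg (k %% N)) = 0 by lra.
by move/eqP; rewrite mulf_eq0 (gt_eqF d0) orbF subr_eq0 => /eqP.
Qed.

Lemma sub_param0 k : sub_param k 0 = sg (k %% N).
Proof. by rewrite /sub_param; ring. Qed.

Lemma sub_param1 k : sub_param k 1 = sg (k %% N).+1.
Proof. by rewrite /sub_param; ring. Qed.

(** No breakpoint lies strictly between two consecutive ones. *)
Lemma sub_param_breakpoint k s r : 0 <= s <= 1 -> (r <= N)%N ->
  sub_param k s = sg r -> s = 0 \/ s = 1.
Proof.
move=> s01 rN e; have /andP[h1 h2] := sub_param_bounds k s01.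
have [rk|kr] := leqP r (k %% N).
  left; apply: (@sub_param_inj k); rewrite sub_param0; apply/eqP.
  by rewrite eq_le h1 e (breakpoints_le sg_step)// ltnW.
right; apply: (@sub_param_inj k); rewrite sub_param1; apply/eqP.
by rewrite eq_le h2 e (breakpoints_le sg_step).
Qed.

Lemma seg2_inj i s t : (i < n)%N -> seg2 n w i s = seg2 n w i t -> s = t.
Proof.
case: polyw => _ [wne _] i_n e.
have [f _ fK] := segment_parameter (wne i i_n).
by rewrite -(fK s) -(fK t) -/(seg2 n w i s) -/(seg2 n w i t) e.
Qed.

Lemma same_edge_contact k l s t : (k < m)%N -> (l < m)%N ->
  0 <= s <= 1 -> 0 <= t <= 1 -> (k %/ N = l %/ N)%N -> (k <= l)%N ->
  sub_param k s = sub_param l t ->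
  (k = l /\ s = t) \/ (l = (k.+1 %% m)%N /\ s = 1 /\ t = 0).
Proof.
move=> km lm s01 t01 ekl; rewrite leq_eqVlt => /predU1P[<-|kl] e.
  by left; split=> //; apply: sub_param_inj e.
have rkl : (k %% N < l %% N)%N.
  by move: kl; rewrite {1}(divn_eq k N) {1}(divn_eq l N) ekl ltn_add2l.
have /andP[_ h1] := sub_param_bounds k s01.
have /andP[h2 _] := sub_param_bounds l t01.
have [rl|rl] := ltnP (k %% N).+1 (l %% N).
  have := breakpoints_lt sg_step rl (ltnW (rem_lt l)).
  by rewrite ltNge (le_trans h2)// -e.
have {rl}erl : (l %% N = (k %% N).+1)%N by apply/eqP; rewrite eqn_leq rl rkl.
have el : l = k.+1 by rewrite (divn_eq l N) (divn_eq k N) -ekl erl addnS.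
right; split; first by rewrite modn_small -?el.
rewrite erl in h2; split.
  apply: (@sub_param_inj k); rewrite sub_param1; apply/eqP.
  by rewrite eq_le h1 e h2.
apply: (@sub_param_inj l); rewrite sub_param0 erl; apply/eqP.
by rewrite eq_le h2 -e h1.
Qed.

(** Adjacent edges meet only at parameters [1] and [0], which belong to the last segment of one edge
    and the first of the next. *)
Lemma next_edge_contact k l s t : (k < m)%N -> (l < m)%N ->
  0 <= s <= 1 -> 0 <= t <= 1 -> (l %/ N = (k %/ N).+1 %% n)%N ->
  seg2 n w (k %/ N) (sub_param k s) = seg2 n w (l %/ N) (sub_param l t) ->
  l = (k.+1 %% m)%N /\ s = 1 /\ t = 0.
Proof.
move=> km lm s01 t01 ekl e; case: polyw => _ [_ [adj _]].
rewrite ekl in e.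
have [es et] := adj _ _ _ (edge_lt km) (sub_param01 k s01) (sub_param01 l t01) e.
have /andP[_ h1] := sub_param_bounds k s01.
have /andP[h2 _] := sub_param_bounds l t01.
have rk : (k %% N).+1 = N.
  apply/eqP; rewrite eqn_leq rem_lt leqNgt; apply/negP => lt.
  have := breakpoints_lt sg_step lt (leqnn N).
  by rewrite sgN -es ltNge h1.
have rl : (l %% N = 0)%N.
  apply/eqP; rewrite -leqn0 leqNgt; apply/negP => lt.
  have := breakpoints_lt sg_step lt (ltnW (rem_lt l)).
  by rewrite sg0 -et ltNge h2.
split; last split.
- rewrite (divn_eq l N) rl addn0 ekl (_ : k.+1 = (k %/ N).+1 * N)%N ?muln_modl//.
  by rewrite {1}(divn_eq k N) -addnS rk mulSnr.
- by apply: (@sub_param_inj k); rewrite sub_param1 rk sgN.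
- by apply: (@sub_param_inj l); rewrite sub_param0 rl sg0.
Qed.

Lemma crossing_contact k l s t : (k < m)%N -> (l < m)%N ->
  0 <= s <= 1 -> 0 <= t <= 1 -> (k %/ N <> l %/ N)%N ->
  ~ Defs.adjacent n (k %/ N) (l %/ N) ->
  seg2 n w (k %/ N) (sub_param k s) = seg2 n w (l %/ N) (sub_param l t) ->
  s = 0 \/ s = 1.
Proof.
move=> km lm s01 t01 nkl nadj e.
have [|r rN er] := @sg_crossing (k %/ N) (sub_param k s).
  exists (l %/ N)%N, (sub_param l t); split; first by split=> //; exact: edge_lt.
  by split=> //; exact: sub_param01.
by apply: (sub_param_breakpoint s01 (ltnW rN)); rewrite er.
Qed.

(** The cases come from edges that coincide, are adjacent, or cross. This one list yields both the
    embeddedness of the polygon and the compatibility of the height differences. *)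
Lemma shadow_contact k l s t : (k < m)%N -> (l < m)%N ->
  0 <= s <= 1 -> 0 <= t <= 1 ->
  seg2 n w (k %/ N) (sub_param k s) = seg2 n w (l %/ N) (sub_param l t) ->
  [\/ k = l /\ s = t,
      l = (k.+1 %% m)%N /\ s = 1 /\ t = 0,
      k = (l.+1 %% m)%N /\ s = 0 /\ t = 1 |
      [/\ s = 0 \/ s = 1, t = 0 \/ t = 1 &
          z (k %/ N) (sub_param k s) <> z (l %/ N) (sub_param l t)]].
Proof.
move=> km lm s01 t01 e.
have [ekl|nkl] := pselect (k %/ N = l %/ N)%N.
  have e' : sub_param k s = sub_param l t.
    by apply: (seg2_inj (edge_lt km)); rewrite e ekl.
  have [kl|/ltnW lk] := leqP k l.
    by have [h|h] := same_edge_contact km lm s01 t01 ekl kl e'; [apply: Or41|apply: Or42].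
  have [[-> ->]|[h1 [h2 h3]]] := same_edge_contact lm km t01 s01 (esym ekl) lk (esym e').
    exact: Or41.
  exact: Or43.
have [[adj|adj]|nadj] := pselect (Defs.adjacent n (k %/ N) (l %/ N)).
- by apply: Or42; exact: next_edge_contact e.
- apply: Or43.
  by have [-> [-> ->]] := next_edge_contact lm km t01 s01 adj (esym e).
apply: Or44; split.
- exact: crossing_contact nkl nadj e.
- apply: crossing_contact lm km t01 s01 _ _ (esym e); first exact/nesym.
  by case=> h; apply: nadj; [right|left].
- case: liftz => _ [_ zne]; apply: zne => //; try exact: edge_lt.
  + exact: sub_param01.
  + exact: sub_param01.
Qed.

Lemma subdivided_end_height k s : (k < m)%N -> s = 0 \/ s = 1 ->
  seg3 m subdivided k s 0 ord_max = z (k %/ N) (sub_param k s).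
Proof.
by move=> km [->|->]; rewrite seg3_height// ?sub_param0 ?sub_param1; ring.
Qed.

Lemma shadow_subdivided_neq k : (k < m)%N ->
  shadow (subdivided k) <> shadow (subdivided (k.+1 %% m)%N).
Proof.
move=> km; rewrite subdivided_next// !shadow_lift_point => /seg2_inj.
move=> /(_ (edge_lt km)) e; have := sg_step (rem_lt k).
by rewrite -e ltxx.
Qed.

(** A contact in space projects to a contact of shadows. At a crossing both points are segment ends,
    where the polygon has the heights of the lift, and these differ. *)
Lemma polygonal_subdivided : polygonal_knot m subdivided.
Proof.
split; first by case: polyw => n3 _; rewrite (leq_trans n3)// leq_pmulr.
split=> [k km e|k l s t km lm kl s01 t01 e].
  by apply: (shadow_subdivided_neq km); rewrite -e.
have := congr1 (@shadow R) e; rewrite !shadow_seg3// => e'.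
case: (shadow_contact km lm s01 t01 e') => [[//]|h|h|[hs ht zne]]; [by left|by right|].
by case: zne; rewrite -!subdivided_end_height// e.
Qed.

Lemma subdivided_isotopic :
  ambient_isotopic (knot_set m subdivided) (lift_set n w z).
Proof.
pose c k s := shadow (seg3 m subdivided k s).
(* Height of the lift above the chord, that is, the vertical displacement needed. *)
pose g k s := z (k %/ N)%N (sub_param k s) -
  ((1 - s) * z (k %/ N)%N (sg (k %% N)) + s * z (k %/ N)%N (sg (k %% N).+1)).
have cE k s : c k s = (1 - s) *: shadow (subdivided k) +
    s *: shadow (subdivided (k.+1 %% m)%N) by exact: shadowD.
have /choice[inv invP] : forall k, exists f : 'rV[R]_2 -> R, (k < m)%N ->
    continuous f /\ cancel (c k) f.
  move=> k; have [km|] := boolP (k < m)%N; last by exists (fun=> 0).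
  have [f cf fK] := segment_parameter (shadow_subdivided_neq km).
  by exists f => _; split=> // s; rewrite cE.
have g0 k s : (k < m)%N -> s = 0 \/ s = 1 -> g k s = 0.
  by move=> km s01; rewrite /g -seg3_height// subdivided_end_height// subrr.
have cont_g k : (k < m)%N -> {within `[0, 1], continuous (g k)}.
  move=> km; case: liftz => /(_ _ (edge_lt km)) cz _.
  have aff a b : continuous (fun s : R => (1 - s) * a + s * b).
    move=> s; apply: cvgD; apply: cvgM; [|exact: cvg_cst|exact: cvg_id|exact: cvg_cst].
    by apply: cvgB; [exact: cvg_cst|exact: cvg_id].
  have czs : {within `[0, 1], continuous (z (k %/ N)%N \o sub_param k)}.
    apply: (within_comp_continuous (f := sub_param k) _ _ cz).
      by move=> s; rewrite /= !in_itv /=; exact: sub_param01.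
    exact/continuous_subspaceT/aff.
  apply/subspace_continuousP => s s01; rewrite /g.
  apply: cvgB; first by move/subspace_continuousP: czs; exact.
  by apply: cvg_within_filter; exact: aff.
have [||||||G [cG GE]] := @glued_extension R 'rV[R]_2 m c inv g.
- exact: norm_hausdorff.
- by move=> k _; rewrite (funext (cE k)); exact: segment_continuous.
- by move=> k /invP[].
- by move=> k /invP[].
- exact: cont_g.
(* Distinct segments have common shadow points only at their ends, where [g] vanishes. *)
- move=> k l s t km lm s01 t01; rewrite /c !shadow_seg3// => e.
  have [[-> ->]//|[_ [-> ->]]|[_ [-> ->]]|[hs ht _]] :=
    shadow_contact km lm s01 t01 e; rewrite !g0//; by [left|right].
have shearE k s : (k < m)%N -> 0 <= s <= 1 ->
    shear G 1 (seg3 m subdivided k s) = lift_point (k %/ N) (sub_param k s).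
  move=> km s01.
  have [sh3 sl] := (shadow_seg3 s km, shadow_lift_point (k %/ N) (sub_param k s)).
  have sh : shadow (shear G 1 (seg3 m subdivided k s)) =
      shadow (lift_point (k %/ N) (sub_param k s)).
    by rewrite shadow_shear sh3 sl.
  apply: row3P.
  - by move/(congr1 (fun x : 'rV[R]_2 => x 0 0)): sh; rewrite !shadowE.
  - by move/(congr1 (fun x : 'rV[R]_2 => x 0 1)): sh; rewrite !shadowE.
  - rewrite lift_point_height /shear -/(c k s) GE// /g -seg3_height//.
    by move: (seg3 m subdivided k s) => x; rewrite !mxE !eqxx/=; ring.
rewrite (_ : lift_set n w z = shear G 1 @` knot_set m subdivided).
  exact: shear_isotopic.
apply/seteqP; split=> [x [i [s [i_n [s01 ->]]]]|x [_ [k [s [km [s01 ->]]]] <-]].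
  (* A point of the lift is reached by bracketing its parameter between breakpoints [r] and [r.+1]
     of edge [i]; the segment is then [i * N + r], and [t] inverts [sub_param]. *)
  have [|r rN rs] := @breakpoints_bracket _ N sg s _ N_gt0; first by rewrite sg0 sgN.
  have km : (i * N + r < m)%N.
    apply: (@leq_trans (i.+1 * N)%N); last by rewrite leq_mul2r i_n orbT.
    by rewrite mulSnr ltn_add2l.
  have kN : ((i * N + r) %/ N = i)%N by rewrite divnMDl// (divn_small rN) addn0.
  have kr : ((i * N + r) %% N = r)%N by rewrite modnMDl (modn_small rN).
  have d0 := sg_step rN; rewrite -subr_gt0 in d0.
  pose t := (s - sg r) / (sg r.+1 - sg r).
  have t01 : 0 <= t <= 1.
    case/andP: rs => rs1 rs2; rewrite /t ler_pdivrMr// mul1r lerD2r rs2 andbT.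
    by rewrite divr_ge0 ?subr_ge0// -subr_ge0 ltW.
  exists (seg3 m subdivided (i * N + r) t); first by exists (i * N + r)%N, t; split.
  rewrite shearE// kN /sub_param kr (_ : _ + _ = s)//.
  by rewrite /t; field; rewrite gt_eqF.
rewrite shearE//; exists (k %/ N)%N, (sub_param k s).
by split; [exact: edge_lt|split; [exact: sub_param01|]].
Qed.

End Subdivision.

(** * Finiteness of the crossings and choice of the viewing direction *)

Section DiagramDirection.
Variables (R : realType) (n : nat) (w : nat -> 'rV[R]_2).
Hypothesis polyw : planar_stick_polygon n w.

(** Subtracting the two equations makes [s - s'] times one edge vector equal to [t - t'] times the
    other; the cross product with the latter leaves [(s - s') * a = 0]. *)
Lemma crossing_param_unique i j s s' t t' :
  cross2 (w (i.+1 %% n)%N - w i) (w (j.+1 %% n)%N - w j) != 0 ->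
  seg2 n w i s = seg2 n w j t -> seg2 n w i s' = seg2 n w j t' -> s = s'.
Proof.
rewrite /cross2 => c0 /rowP e /rowP e'; apply/eqP; rewrite -subr_eq0.
have := (e 0, e 1, e' 0, e' 1); rewrite /seg2 !mxE => -[[[h1 h2] h3] h4].
rewrite !mxE in c0; set a := (X in X != 0) in c0.
suff /eqP : (s - s') * a = 0 by rewrite mulf_eq0 (negbTE c0) orbF.
rewrite /a.
set i0 := w i 0 0 in h1 h3 *; set i1 := w i 0 1 in h2 h4 *.
set k0 := w (i.+1 %% n)%N 0 0 in h1 h3 *; set k1 := w (i.+1 %% n)%N 0 1 in h2 h4 *.
set j0 := w j 0 0 in h1 h3 *; set j1 := w j 0 1 in h2 h4 *.
set l0 := w (j.+1 %% n)%N 0 0 in h1 h3 *; set l1 := w (j.+1 %% n)%N 0 1 in h2 h4 *.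
have f0 : (s - s') * (k0 - i0) = (t - t') * (l0 - j0) by lra.
have f1 : (s - s') * (k1 - i1) = (t - t') * (l1 - j1) by lra.
by rewrite mulrBr !mulrA f0 f1; ring.
Qed.

Lemma crossing_params : exists S : seq R,
  forall i s, crossing_param n w i s -> 0 <= s < 1 /\ s \in S.
Proof.
pose P i j : set R := [set s | exists t,
  [/\ (i < n)%N, (j < n)%N, i <> j & ~ Defs.adjacent n i j] /\
  [/\ 0 <= s <= 1, 0 <= t <= 1 & seg2 n w i s = seg2 n w j t]].
(* One entry per ordered pair of edges suffices by uniqueness; pairs without a crossing add the
   harmless default [0]. *)
exists [seq xget 0 (P i j) | i <- iota 0 n, j <- iota 0 n].
move=> i s [j [t [[i_n j_n ij nadj] [s01 t01 e]]]].
have [_ [_ [_ [tr _]]]] := polyw.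
have [/andP[s0 s1] [_ c0]] := tr _ _ _ _ i_n j_n ij nadj s01 t01 e.
split; first by rewrite ltW.
apply/allpairsP; exists (i, j); rewrite !mem_iota /= add0n; split=> //.
case: xgetP => [s' -> [t' [_ [_ _ e']]]|/(_ s)].
  exact: crossing_param_unique c0 e e'.
by case; exists t.
Qed.

(** Edge [0] is turned by a right angle and normalised. The third coordinate is zero, so heights are
    a linear function [phi] of the shadow. *)
Lemma planar_direction : exists (p : 'rV[R]_3) (phi : 'rV[R]_2 -> R),
  [/\ unit_dir p, forall x, dot3 p x = phi (shadow x),
      phi (w 0%N) = phi (w 1%N) &
      forall (a b : R) x y, phi (a *: x + b *: y) = a * phi x + b * phi y].
Proof.
have [n3 [wne _]] := polyw.
have w01 : w 0%N <> w 1%N.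
  by have := wne 0%N (ltnW (ltnW n3)); rewrite modn_small// ltnW.
pose dx := w 1%N 0 0 - w 0%N 0 0; pose dy := w 1%N 0 1 - w 0%N 0 1.
pose q := dx ^+ 2 + dy ^+ 2.
have q0 : 0 < q.
  rewrite lt_neqAle addr_ge0 ?sqr_ge0// andbT eq_sym paddr_eq0 ?sqr_ge0//.
  rewrite !sqrf_eq0 !subr_eq0; apply/negP => /andP[/eqP ex /eqP ey]; apply: w01.
  by apply: row2P.
pose L := Num.sqrt q.
have L2 : L * L = q by rewrite -expr2 sqr_sqrtr// ltW.
have L0 : L != 0 by rewrite gt_eqF// sqrtr_gt0.
exists (mk3 (- dy / L) (dx / L) 0).
have dotE x y c (v : 'rV[R]_3) :
    dot3 (mk3 x y c) v = x * v 0 0 + y * v 0 1 + c * v 0 ord_max.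
  rewrite /dot3 !big_ord_recl big_ord0 addr0 addrA ![mk3 _ _ _ _ _]mxE /=.
  by congr (_ * v _ _ + _ * v _ _ + _ * v _ _); exact: val_inj.
exists (fun x => (- dy / L) * x 0 0 + (dx / L) * x 0 1); split.
- rewrite /unit_dir dotE !mxE/= mul0r addr0.
  transitivity (q / (L * L)); first by rewrite /q; field.
  by rewrite L2 divff// gt_eqF.
- by move=> x; rewrite dotE mul0r addr0 !shadowE.
- by rewrite /dx /dy; field.
- by move=> a b x y; rewrite !mxE; ring.
Qed.
End DiagramDirection.

(** * From a diagram to a bound on bridges *)

Lemma diagram_bridge_presentation (R : realType) (n : nat) (w : nat -> 'rV[R]_2)
    (z : nat -> R -> R) :
  planar_stick_polygon n w -> diagram_lift n w z ->
  exists m u p, [/\ polygonal_knot m u,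
    ambient_isotopic (knot_set m u) (lift_set n w z), unit_dir p &
    (2 * br_at m u p + 1 <= n)%N].
Proof.
move=> polyw liftz; have n3 : (3 <= n)%N by case: polyw.
have n_gt0 : (0 < n)%N by exact: ltnW (ltnW n3).
have [S SP] := crossing_params polyw.
have [N [sg [N_gt0 sg0 sgN sg_step sgS]]] := breakpointsP S.
have sg_crossing i s : crossing_param n w i s -> exists2 r, (r < N)%N & sg r = s.
  by move=> /SP[s01 sS]; exact: sgS.
have [p [phi [p1 pphi phi01 phiD]]] := planar_direction polyw.
pose u := subdivided n w z N sg.
have m_gt0 : (0 < n * N)%N by rewrite muln_gt0 n_gt0.
exists (n * N)%N, u, p; split=> //.
- exact: polygonal_subdivided.
- exact: subdivided_isotopic.
rewrite /br_at; set h := vheight _ _ _.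
(* At constant height [br_at] is [1], and the bound is [3 <= n]. *)
case: ifP => _; first by [].
pose D e := phi (w (e.+1 %% n)%N) - phi (w e).
have D0 : D 0%N = 0 by rewrite /D modn_small ?phi01 ?subrr// ltnW.
have h_mod k : h k = h (k %% (n * N))%N by rewrite /h /vheight modn_mod.
(* A segment rises by the rise [D] of its edge times the positive gap between two breakpoints. *)
have h_step k : Num.sg (h k.+1 - h k) = Num.sg (D ((k %% (n * N)) %/ N)%N).
  have km : (k %% (n * N) < n * N)%N by rewrite ltn_mod.
  have d0 := sg_step _ (ltn_pmod (k %% (n * N)) N_gt0); rewrite -subr_gt0 in d0.
  rewrite /h /vheight -(addn1 k) -modnDml addn1 !pphi /u (subdivided_next liftz)// /subdivided.
  rewrite !shadow_lift_point /seg2 !phiD /D.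
  set r := ((k %% (n * N)) %% N)%N in d0 *; set a := ((k %% (n * N)) %/ N)%N.
  rewrite -[RHS](mul1r) -(gtr0_sg d0) -sgrM; congr (Num.sg _); ring.
set M := [set i | _].
(* [br_at] counts a classical set, recast here as a finite set of the same cardinality. *)
have := @twice_maxima_le _ n N h D N_gt0 n_gt0 h_mod h_step D0 (finset (mem M)).
rewrite cardsE; apply=> i; rewrite inE => /set_mem /andP[up].
move=> /existsP[k /andP[/forallP run down]]; split=> //; exists k; split.
  move=> j jk; have jm := leq_ltn_trans jk (ltn_ord k).
  by apply/eqP; have /implyP/(_ jk) := run (Ordinal jm).
by rewrite -addn1.
Qed.

(** A diagram with [q] edges gives a polygon isotopic to its lift, hence by transitivity a
    conformation of the knot, whose maxima number at least [b]. *)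
Theorem theorem2p4 (R : realType) (n0 : nat) (v0 : nat -> 'rV[R]_3)
    (b q : nat) :
  polygonal_knot n0 v0 ->
  is_bridge_index n0 v0 b ->
  is_planar_stick_index n0 v0 q ->
  (2 * b + 1 <= q)%N.
Proof.
move=> _ [_ b_min] [[w [z [polyw [liftz isoz]]]] _].
have [m [u [p [polyu isou p1 br]]]] := diagram_bridge_presentation polyw liftz.
apply: leq_trans br; rewrite leq_add2r leq_mul2l/=.
by apply: b_min => //; split=> //; exact: ambient_isotopic_trans isou isoz.
Qed.
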